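(* Consider the LWFR blending scheme $$\boldsymbol u^{n+1}_{e,\boldsymbol p}=(1-\alpha_e)\,\boldsymbol u^{H,n+1}_{e,\boldsymbol p}+\alpha_e\,\boldsymbol u^{L,n+1}_{e,\boldsymbol p},\qquad \alpha_e\in[0,1],$$ on a curvilinear grid, where $\boldsymbol u^{H,n+1}$ is the high order LWFR update and $\boldsymbol u^{L,n+1}$ is the lower order update by the first order finite volume scheme on subcells (both defined in the context), and where the low and high order schemes use the same numerical flux $(\tilde{\boldsymbol F}^\delta_e\cdot\hat{\boldsymbol n}_{S,i})^*$ at every element interface. Then: 1. The element means of the low and high order updates are the same, $\overline{\boldsymbol u}^{L,n+1}_e=\overline{\boldsymbol u}^{H,n+1}_e$ for every element $e$; and thus the blended scheme is admissibility preserving in means if and only if the lower order scheme is admissibility preserving in means. 2. Suppose that, whenever $\boldsymbol u^n_{e,\boldsymbol p}\in\mathcal U_{\mathrm{ad}}$ for all $e,\boldsymbol p$, the first order finite volume updates at the inner solution points are admissible, i.e. $\boldsymbol u^{L,n+1}_{e,\boldsymbol p}\in\mathcal U_{\mathrm{ad}}$ for all $e$ and all $\boldsymbol p$ with $1\le p_i\le N-1$ for every $i$. If the interface flux $(\tilde{\boldsymbol F}^\delta_e\cdot\hat{\boldsymbol n}_{S,i})^*$ is chosen so that, whenever $\boldsymbol u^n_{e,\boldsymbol p}\in\mathcal U_{\mathrm{ad}}$ for all $e,\boldsymbol p$, the lower order updates at the solution points adjacent to the interfaces are admissible, i.e. $\boldsymbol u^{L,n+1}_{e,\boldsymbol p}\in\mathcal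 U_{\mathrm{ad}}$ for all $e$ and all $\boldsymbol p$ with $p_i\in\{0,N\}$ for some $i$, then the blending scheme is admissibility preserving in means.
   Context: **Admissibility.** The conservation law is $\boldsymbol u_t+\sum_{n=1}^d\partial_{x_n}\boldsymbol f_n(\boldsymbol u)=\boldsymbol 0$ with $\boldsymbol u\in\mathbb R^s$. $\mathcal U_{\mathrm{ad}}\subset\mathbb R^s$ is a convex set, the admissibility set. A scheme with nodal values $\boldsymbol u_{e,\boldsymbol p}$ is *admissibility preserving in means* if: $\boldsymbol u^n_{e,\boldsymbol p}\in\mathcal U_{\mathrm{ad}}$ for all $e,\boldsymbol p$ implies $\overline{\boldsymbol u}_e^{n+1}\in\mathcal U_{\mathrm{ad}}$ for all $e$. The element mean is $\overline{\boldsymbol u}_e=\frac1{|\Omega_e|}\sum_{\boldsymbol p}\boldsymbol u_{e,\boldsymbol p}J_{e,\boldsymbol p}w_{\boldsymbol p}$ with $|\Omega_e|=\sum_{\boldsymbol p}J_{e,\boldsymbol p}w_{\boldsymbol p}$. **Reference element.** $N\ge1$; $-1=\xi_0<\dots<\xi_N=1$ are the Gauss–Legendre–Lobatto (GLL) points with positive quadrature weights $w_0,\dots,w_N$ on $[-1,1]$ (quadrature exact for polynomials of degree at most $2N-1$). For $\boldsymbol p\in\{0,\dots,N\}^d$, $\boldsymbol\xi_{\boldsymbol p}=(\xi_{p_1},\dots,\xi_{p_d})\in[-1,1]^d$ are the solution points and $w_{\boldsymbol p}=\prod_iw_{p_i}$. Each curvilinear element $\Omega_e$ is the image of $[-1,1]^d$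 under a map whose Jacobian has values $J_{e,\boldsymbol p}>0$ at the solution points; the metric terms $J\boldsymbol a^i=J\nabla_{\boldsymbol x}\xi^i$ are represented by $\mathbb R^d$-valued polynomials $A^i_e=\mathbb{I}_N(J\boldsymbol a^i)_e$ of degree at most $N$ in each variable. The face $(S,i)$ is $\{\xi^i=-1\}$ for $S=L$ and $\{\xi^i=1\}$ for $S=R$, with reference outward normal $\hat{\boldsymbol n}_{R,i}=\boldsymbol e_i=-\hat{\boldsymbol n}_{L,i}$; for a solution point $\boldsymbol\xi$, $\boldsymbol\xi_i^S$ is $\boldsymbol\xi$ with $i$-th coordinate replaced by $-1$ ($S=L$) or $1$ ($S=R$). **High order (LWFR) scheme.** $\tilde{\boldsymbol F}^\delta_e=(\tilde{\boldsymbol F}^{\delta,1}_e,\dots,\tilde{\boldsymbol F}^{\delta,d}_e)$ is the element-local approximation of the time average over $[t_n,t_{n+1}]$ of the contravariant flux $\tilde{\boldsymbol f}^i(\boldsymbol u)=\sum_nA^i_{e,n}\boldsymbol f_n(\boldsymbol u)$: each $\tilde{\boldsymbol F}^{\delta,i}_e$ is an $\mathbb R^s$-valued polynomial of degree at most $N$ in each variable determined by $\{\boldsymbol u^n_{e,\boldsymbol p}\}_{\boldsymbol p}$ through $\tilde{\boldsymbol F}^{\delta,i}_e=\sum_{k=0}^N\frac{\Delta t^k}{(k+1)!}\tilde{\boldsymbol f}^{\delta,(k),i}$. Here $\tilde{\boldsymbol f}^{\delta,(0),i}$ interpolates $\tilde{\boldsymbol f}^i(\boldsymbol u^n_{e,\boldsymbol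 p})$ at the solution points; $\tilde{\boldsymbol f}^{\delta,(k),i}$ interpolates a finite-difference-in-time approximation of the $k$-th time derivative, namely nodal values $\Delta t^{-k}\sum_jc^{(k)}_j\tilde{\boldsymbol f}^i\big(\sum_{m=0}^k\frac{(j\Delta t)^m}{m!}\boldsymbol u^{(m)}_{\boldsymbol p}\big)$ with $c_j^{(k)}$ the coefficients of a consistent finite difference formula for the $k$-th derivative, $\boldsymbol u^{(0)}_{\boldsymbol p}=\boldsymbol u^n_{e,\boldsymbol p}$, $\boldsymbol u^{(k)}_{\boldsymbol p}=-J_{e,\boldsymbol p}^{-1}\sum_i\partial_{\xi^i}\tilde{\boldsymbol f}^{\delta,(k-1),i}(\boldsymbol\xi_{\boldsymbol p})$. Put $\tilde{\boldsymbol F}^\delta_e\cdot\hat{\boldsymbol n}_{R,i}=\tilde{\boldsymbol F}^{\delta,i}_e=-\tilde{\boldsymbol F}^\delta_e\cdot\hat{\boldsymbol n}_{L,i}$. The interface numerical flux $(\tilde{\boldsymbol F}^\delta_e\cdot\hat{\boldsymbol n}_{S,i})^*$ is given by values in $\mathbb R^s$ at the GLL points of each face $(S,i)$ of each element $e$, determined by $\boldsymbol u^n$ (the ''blended numerical flux''). The correction functions $g_L,g_R$ are polynomials of degree at most $N+1$ with $g_L(-1)=g_R(1)=1$, $g_L(1)=g_R(-1)=0$. The high order update is, with $\boldsymbol\xi=\boldsymbol\xi_{\boldsymbol p}$, $$\boldsymbol u^{H,n+1}_{e,\boldsymbol p}=\boldsymbol u^n_{e,\boldsymbol p}-\frac{\Delta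 t}{J_{e,\boldsymbol p}}\sum_{i=1}^d\Big\{\partial_{\xi^i}\tilde{\boldsymbol F}^{\delta,i}_e(\boldsymbol\xi_{\boldsymbol p})+\big((\tilde{\boldsymbol F}^\delta_e\cdot\hat{\boldsymbol n}_{R,i})^*-\tilde{\boldsymbol F}^\delta_e\cdot\hat{\boldsymbol n}_{R,i}\big)(\boldsymbol\xi_i^R)g_R'(\xi_{p_i})-\big((\tilde{\boldsymbol F}^\delta_e\cdot\hat{\boldsymbol n}_{L,i})^*-\tilde{\boldsymbol F}^\delta_e\cdot\hat{\boldsymbol n}_{L,i}\big)(\boldsymbol\xi_i^L)g_L'(\xi_{p_i})\Big\}.$$ **Lower order scheme.** The reference element is divided into subcells $C_{\boldsymbol p}$ (products of intervals of lengths $w_{p_i}$), one per solution point. With $\boldsymbol p_{i\pm}$ denoting $\boldsymbol p$ with $p_i$ replaced by $p_i\pm1$, $$\boldsymbol u^{L,n+1}_{e,\boldsymbol p}=\boldsymbol u^n_{e,\boldsymbol p}-\frac{\Delta t}{J_{e,\boldsymbol p}}\sum_{i=1}^d\frac1{w_{p_i}}\big[\Phi^{R,i}_{e,\boldsymbol p}+\Phi^{L,i}_{e,\boldsymbol p}\big].$$ At element interfaces the fluxes are those of the high order scheme: $\Phi^{R,i}_{e,\boldsymbol p}=(\tilde{\boldsymbol F}^\delta_e\cdot\hat{\boldsymbol n}_{R,i})^*(\boldsymbol\xi_i^R)$ if $p_i=N$, and $\Phi^{L,i}_{e,\boldsymbol p}=(\tilde{\boldsymbol F}^\delta_e\cdot\hat{\boldsymbol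 n}_{L,i})^*(\boldsymbol\xi_i^L)$ if $p_i=0$. At subcell faces interior to the element, $$\Phi^{R,i}_{e,\boldsymbol p}=\|\boldsymbol n\|\,\boldsymbol f^*\Big(\boldsymbol u^n_{e,\boldsymbol p},\boldsymbol u^n_{e,\boldsymbol p_{i+}},\tfrac{\boldsymbol n}{\|\boldsymbol n\|}\Big),\ \boldsymbol n=(\boldsymbol n_{R,i})_{\boldsymbol p}\ (p_i<N);\qquad \Phi^{L,i}_{e,\boldsymbol p}=\|\boldsymbol n\|\,\boldsymbol f^*\Big(\boldsymbol u^n_{e,\boldsymbol p},\boldsymbol u^n_{e,\boldsymbol p_{i-}},\tfrac{\boldsymbol n}{\|\boldsymbol n\|}\Big),\ \boldsymbol n=(\boldsymbol n_{L,i})_{\boldsymbol p}\ (p_i>0),$$ where the subcell normals (assumed nonzero) are $(\boldsymbol n_{R,i})_{\boldsymbol p}=A^i_e(\boldsymbol\xi_{\boldsymbol p_{i|0}})+\sum_{l=0}^{p_i}w_l\,\partial_{\xi^i}A^i_e(\boldsymbol\xi_{\boldsymbol p_{i|l}})$, with $\boldsymbol p_{i|l}$ denoting $\boldsymbol p$ with $i$-th entry replaced by $l$, and $(\boldsymbol n_{L,i})_{\boldsymbol p}=-(\boldsymbol n_{R,i})_{\boldsymbol p_{i-}}$. Here $\boldsymbol f^*$ is Rusanov's flux $$\boldsymbol f^*(\boldsymbol u^-,\boldsymbol u^+,\boldsymbol n)=\tfrac12\sum_{m=1}^d n_m\big(\boldsymbol f_m(\boldsymbol u^+)+\boldsymbol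 f_m(\boldsymbol u^-)\big)-\tfrac\lambda2(\boldsymbol u^+-\boldsymbol u^-),$$ with a wave speed estimate $\lambda=\lambda(\boldsymbol u^-,\boldsymbol u^+,\boldsymbol n)=\lambda(\boldsymbol u^+,\boldsymbol u^-,-\boldsymbol n)\ge0$ (one value per face). The blending coefficients $\alpha_e\in[0,1]$ are one number per element, determined by $\boldsymbol u^n$. *)

(* Defs.v *)
From HB Require Import structures.
From mathcomp Require Import all_boot all_order all_algebra.
(* The notations of mpoly clash with those of mathcomp-analysis. *)
From mathcomp Require Import -(notations) mpoly.
From mathcomp Require Import all_classical all_reals all_analysis.
Import Order.TTheory GRing.Theory Num.Theory numFieldNormedType.Exports.

Set Implicit Arguments.
Unset Strict Implicit.
Unset Printing Implicit Defensive.

Local Open Scope classical_set_scope.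
Local Open Scope ring_scope.

Inductive side := Left | Right.

Section OneDimension.
Variable R : realType.
Implicit Types N k : nat.

(* Rodrigues' formula *)
Definition legendre N : {poly R} :=
  (2 ^+ N * N`!%:R)^-1 *: (('X ^+ 2 - 1) ^+ N)^`(N).

(* The interior Gauss-Legendre-Lobatto points are the roots of the derivative
   of the N-th Legendre polynomial.  Degree at most 2N-1 is size at most 2N. *)
Definition is_GLL N (xi w : 'I_N.+1 -> R) : Prop :=
  [/\ xi ord0 = -1 /\ xi ord_max = 1,
      forall j k : 'I_N.+1, (j < k)%N -> xi j < xi k,
      forall j : 'I_N.+1, (0 < j < N)%N -> root (legendre N)^`() (xi j),
      forall j, 0 < w j
    & forall q : {poly R}, (size q <= 2 * N)%N ->
        \int[lebesgue_measure]_(x in `[-1, 1]) q.[x]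
          = \sum_j w j * q.[xi j]].

Definition is_correction N (g : side -> {poly R}) : Prop :=
  [/\ forall sd, (size (g sd) <= N.+2)%N,
      (g Left).[-1] = 1 /\ (g Left).[1] = 0
    & (g Right).[-1] = 0 /\ (g Right).[1] = 1].

Definition smooth (phi : R -> R) : Prop :=
  forall n t, derivable (derive1n n phi) t 1.

(* The stencil st is a finite list of integer offsets j, used with
   coefficients c j, for the k-th derivative. *)
Definition fd_consistent k (st : seq int) (c : int -> R) : Prop :=
  forall (phi : R -> R) (t : R), smooth phi ->
    (h ^- k * \sum_(j <- st) c j * phi (t + j%:~R * h)) @[h --> 0^']
      --> derive1n k phi t.

Definition lagrange_basis N (xi : 'I_N.+1 -> R) (j : 'I_N.+1) : {poly R} :=
  \prod_(k < N.+1 | k != j) ((xi j - xi k)^-1 *: ('X - (xi k)%:P)).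

Lemma lagrange_basis_node N (xi : 'I_N.+1 -> R) (j k : 'I_N.+1) :
  injective xi -> (lagrange_basis xi j).[xi k] = (j == k)%:R.
Proof.
move=> xi_inj; rewrite /lagrange_basis horner_prod.
have [<-|jk] := eqVneq j k.
  apply: big1 => l lj; rewrite !hornerE mulVf//.
  by rewrite subr_eq0; apply: contra_neq lj => /xi_inj.
rewrite (bigD1 k) 1?eq_sym//= !hornerE subrr.
by rewrite mulr0 mul0r.
Qed.

End OneDimension.

Section Nodes.
Variables (d N : nat).

Definition node := {ffun 'I_d -> 'I_N.+1}.

Definition setn (p : node) (i : 'I_d) (l : 'I_N.+1) : node :=
  [ffun j => if j == i then l else p j].

Definition node_next (p : node) (i : 'I_d) : node := setn p i (inord (p i).+1).
Definition node_prev (p : node) (i : 'I_d) : node := setn p i (inord (p i).-1).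

(* As xi_0 = -1 and xi_N = 1, replacing the i-th coordinate of a solution point
   by -1 or 1 yields the solution point of index face_node sd i p.  The nodes
   of the form face_node sd i p are thus the GLL points of the face (sd, i). *)
Definition face_node (sd : side) (i : 'I_d) (p : node) : node :=
  setn p i (if sd is Left then ord0 else ord_max).

End Nodes.

(* Unlike the library's `|_| on row vectors, which is the sup norm. *)
Definition enorm (R : realType) n (v : 'rV[R]_n) : R :=
  Num.sqrt (\sum_m v 0 m ^+ 2).

(* R^k-valued polynomials in d variables are row vectors of polynomials. *)
Definition vmeval (R : realType) d k (x : 'I_d -> R)
  (P : 'rV[mpoly d R]_k) : 'rV[R]_k := map_mx (meval x) P.
Definition vmderiv (R : realType) d k (i : 'I_d)
  (P : 'rV[mpoly d R]_k) : 'rV[mpoly d R]_k := map_mx (mderiv i) P.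

Section Interpolation.
Variables (R : realType) (d N : nat) (xi : 'I_N.+1 -> R).

Definition grid_point (p : node d N) : 'I_d -> R := fun i => xi (p i).

Definition lagrange_basis_nd (p : node d N) : mpoly d R :=
  \prod_(i < d) (map_poly (mpolyC d (R := R))
       (lagrange_basis xi (p i))).[mpolyX R (mnm1 i)].

Definition interp k (v : node d N -> 'rV[R]_k) : 'rV[mpoly d R]_k :=
  \row_c \sum_p v p 0 c *: lagrange_basis_nd p.

Lemma interp_node k (v : node d N -> 'rV[R]_k) (p : node d N) :
  injective xi -> vmeval (grid_point p) (interp v) = v p.
Proof.
move=> xi_inj; apply/rowP => c; rewrite !mxE raddf_sum /= (bigD1 p)//=.
have lagE q : meval (grid_point p) (lagrange_basis_nd q) = (q == p)%:R.
  rewrite /lagrange_basis_nd rmorph_prod /=.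
  under eq_bigr => i _.
    rewrite -horner_map /= -map_poly_comp mevalXU.
    rewrite (_ : map_poly _ _ = lagrange_basis xi (q i)); last first.
      by apply/polyP => n; rewrite coef_map_id0 /= ?mevalC// meval0.
    rewrite lagrange_basis_node//; over.
  have [->|qp] := eqVneq q p; first by apply: big1 => i _; rewrite eqxx.
  have [i qpi] : exists i, q i != p i.
    apply/existsP; rewrite -negb_forall; apply: contra_neqN qp => /forallP qp.
    by apply/ffunP => i; apply/eqP/qp.
  by rewrite (bigD1 i)//= (negbTE qpi) mul0r.
rewrite mevalZ lagE eqxx mulr1 big1 ?addr0// => q qp.
by rewrite mevalZ lagE (negbTE qp) mulr0.
Qed.

End Interpolation.

Definition field (R : realType) (d s N : nat) := node d N -> 'rV[R]_s.
Definition state (R : realType) (d s N : nat) (E : Type) :=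
  E -> field R d s N.

Record lwfr (R : realType) (d s N : nat) (E : Type) := Lwfr {
  flux : 'I_d -> 'rV[R]_s -> 'rV[R]_s;
  gll : 'I_N.+1 -> R;
  weight : 'I_N.+1 -> R;
  elt_map : E -> 'rV[R]_d -> 'rV[R]_d;
  dt : R;
  stencil : nat -> seq int;
  fd_coef : nat -> int -> R;
  corr : side -> {poly R};
  (* only used at the nodes of the face, see face_node *)
  num_flux : state R d s N E -> E -> side -> 'I_d -> node d N -> 'rV[R]_s;
  speed : 'rV[R]_s -> 'rV[R]_s -> 'rV[R]_d -> R;
  blend : state R d s N E -> E -> R }.

Section Scheme.
Variables (R : realType) (d s N : nat) (E : Type) (S : lwfr R d s N E).

Local Notation node := (node d N).
Local Notation field := (field R d s N).
Local Notation state := (state R d s N E).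
Local Notation xi := (gll S).
Local Notation w := (weight S).
Local Notation dt := (dt S).

Definition pt (p : node) : 'I_d -> R := grid_point xi p.
Definition pt_vec (p : node) : 'rV[R]_d := \row_i pt p i.
Definition wnode (p : node) : R := \prod_i w (p i).

(* 'J f x has entry d f_j / d x_i in row i and column j.  The derivative is
   two-sided: elt_map is defined around [-1, 1]^d. *)
Definition jac_mx (e : E) (p : node) : 'M[R]_d := 'J (elt_map S e) (pt_vec p).
Definition jac (e : E) (p : node) : R := \det (jac_mx e p).

(* J a^i = J grad_x xi^i: the inverse of jac_mx has entry d xi^i / d x_m
   in row m and column i. *)
Definition contravariant (e : E) (i : 'I_d) (p : node) : 'rV[R]_d :=
  \row_m (jac e p * invmx (jac_mx e p) m i).
Definition metric (e : E) (i : 'I_d) : 'rV[mpoly d R]_d :=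
  interp xi (contravariant e i).

Definition mean (v : state) (e : E) : 'rV[R]_s :=
  (\sum_p jac e p * wnode p)^-1 *: \sum_p (jac e p * wnode p) *: v e p.

Definition contra_flux (e : E) (i : 'I_d) (p : node) (x : 'rV[R]_s) :
    'rV[R]_s :=
  \sum_m vmeval (pt p) (metric e i) 0 m *: flux S m x.

(* Nodal values of the k-th approximate time derivative of the flux; ud m is
   the field u^(m), of which only the values for m <= k are used. *)
Definition flux_dt (e : E) (i : 'I_d) (k : nat) (ud : nat -> field) : field :=
  fun p =>
  if k == 0 then contra_flux e i p (ud 0 p)
  else dt ^- k *: \sum_(j <- stencil S k) fd_coef S k j *:
         contra_flux e i p
           (\sum_(m < k.+1) ((j%:~R * dt) ^+ m / m`!%:R) *: ud m p).

Definition next_dt (e : E) (k : nat) (ud : nat -> field) : field := fun p =>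
  - ((jac e p)^-1 *:
     \sum_i vmeval (pt p) (vmderiv i (interp xi (flux_dt e i k ud)))).

(* u_tower e u k m is u^(m) for m <= k *)
Fixpoint u_tower (e : E) (u : field) (k : nat) : nat -> field :=
  if k is k'.+1 then
    fun m => if m == k'.+1 then next_dt e k' (u_tower e u k')
             else u_tower e u k' m
  else fun=> u.
Definition u_dt (e : E) (u : field) (k : nat) : field := u_tower e u k k.

Lemma u_tower_le e u k m : (m <= k)%N -> u_tower e u k m = u_dt e u m.
Proof.
elim: k => [|k IH]; first by rewrite leqn0 => /eqP ->.
rewrite leq_eqVlt => /orP[/eqP -> //|]; rewrite ltnS => mk /=.
by rewrite ifN ?IH// neq_ltn ltnS mk.
Qed.

Lemma flux_dt_eq e i k (ud ud' : nat -> field) :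
  (forall m, (m <= k)%N -> ud m = ud' m) ->
  flux_dt e i k ud = flux_dt e i k ud'.
Proof.
move=> udE; apply/funext => p; rewrite /flux_dt udE//.
case: ifP => // _; congr (_ *: _); apply: eq_bigr => j _; congr (_ *: _).
congr contra_flux; apply: eq_bigr => m _; rewrite udE//.
by rewrite -ltnS.
Qed.

Lemma u_dt0 e u : u_dt e u 0 = u. Proof. by []. Qed.

Lemma u_dtS e u k : u_dt e u k.+1 = next_dt e k (u_dt e u).
Proof.
rewrite /u_dt /= eqxx; apply/funext => p; rewrite /next_dt.
congr (- (_ *: _)); apply: eq_bigr => i _.
by congr (vmeval _ (vmderiv _ (interp _ _))); apply: flux_dt_eq => m /u_tower_le.
Qed.

Definition avg_flux (e : E) (u : field) (i : 'I_d) : 'rV[mpoly d R]_s :=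
  \sum_(k < N.+1) mpolyC d (dt ^+ k / k.+1`!%:R) *:
    interp xi (flux_dt e i k (u_dt e u)).

Definition avg_flux_normal (e : E) (u : field) (sd : side) (i : 'I_d) :
    'rV[mpoly d R]_s :=
  if sd is Right then avg_flux e u i else - avg_flux e u i.

Definition flux_jump (u : state) (e : E) (sd : side) (i : 'I_d) (p : node) :
    'rV[R]_s :=
  num_flux S u e sd i (face_node sd i p)
  - vmeval (pt (face_node sd i p)) (avg_flux_normal e (u e) sd i).

Definition high (u : state) : state := fun e p =>
  u e p - (dt / jac e p) *: \sum_i
    (vmeval (pt p) (vmderiv i (avg_flux e (u e) i))
     + (corr S Right)^`().[xi (p i)] *: flux_jump u e Right i p
     - (corr S Left)^`().[xi (p i)] *: flux_jump u e Left i p).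

Definition rusanov (um up : 'rV[R]_s) (n : 'rV[R]_d) : 'rV[R]_s :=
  2^-1 *: \sum_m n 0 m *: (flux S m up + flux S m um)
  - (speed S um up n / 2) *: (up - um).

Definition normalR (e : E) (i : 'I_d) (p : node) : 'rV[R]_d :=
  vmeval (pt (setn p i ord0)) (metric e i)
  + \sum_(l < N.+1 | (l <= p i)%N)
      w l *: vmeval (pt (setn p i l)) (vmderiv i (metric e i)).
Definition normalL (e : E) (i : 'I_d) (p : node) : 'rV[R]_d :=
  - normalR e i (node_prev p i).

Definition inner_flux (um up : 'rV[R]_s) (n : 'rV[R]_d) : 'rV[R]_s :=
  enorm n *: rusanov um up ((enorm n)^-1 *: n).

Definition subcell_flux (u : state) (e : E) (sd : side) (i : 'I_d) (p : node) :
    'rV[R]_s :=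
  match sd with
  | Right => if p i == N :> nat then num_flux S u e Right i (face_node Right i p)
             else inner_flux (u e p) (u e (node_next p i)) (normalR e i p)
  | Left => if p i == 0 :> nat then num_flux S u e Left i (face_node Left i p)
            else inner_flux (u e p) (u e (node_prev p i)) (normalL e i p)
  end.

Definition low (u : state) : state := fun e p =>
  u e p - (dt / jac e p) *: \sum_i (w (p i))^-1 *:
    (subcell_flux u e Right i p + subcell_flux u e Left i p).

Definition blended (u : state) : state := fun e p =>
  (1 - blend S u e) *: high u e p + blend S u e *: low u e p.

Definition admissible (U : set 'rV[R]_s) (u : state) : Prop :=
  forall e p, U (u e p).

Definition adm_preserving_in_means (U : set 'rV[R]_s)
    (scheme : state -> state) : Prop :=
  forall u, admissible U u -> forall e, U (mean (scheme u) e).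

Definition lwfr_valid : Prop :=
  [/\ is_GLL xi w,
      forall e p, differentiable (elt_map S e) (pt_vec p) /\ 0 < jac e p,
      0 < dt,
      forall k, (0 < k <= N)%N -> fd_consistent k (stencil S k) (fd_coef S k)
    & is_correction N (corr S)]
  /\
  [/\ forall um up n, speed S um up n = speed S up um (- n),
      forall um up n, 0 <= speed S um up n,
      forall u e, 0 <= blend S u e <= 1
    & forall e i (p : node), (p i < N)%N -> normalR e i p != 0].

End Scheme.

(* Main.v *)
(* Both updates have the conservative form u - (dt / J) *: sum_i D_i, so their
   means agree once D_i has the same weighted sum over the solution points for
   both schemes, and this can be checked on each grid line in direction i.
   There both sums equal the sum of the two interface fluxes at the ends of the
   line.  For the high order scheme, GLL quadrature is exact on the derivatives
   of the flux polynomial (degree at most N - 1) and of the correction functions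
   (degree at most N <= 2N - 1), so the trace of the local flux cancels.  For the
   low order scheme, the weights w_(p_i) cancel and the inner subcell fluxes
   telescope, Rusanov's flux being antisymmetric under exchange of the two
   states and reversal of the normal.
   The mean of the blended update is then that of the low order update, which is
   a convex combination of its nodal values. *)
Require Import Defs.
From HB Require Import structures.
From mathcomp Require Import all_boot all_order all_algebra.
From mathcomp Require Import all_classical all_reals all_analysis.
From mathcomp Require Import -(notations) mpoly.
From mathcomp Require Import ring.
Import Order.TTheory GRing.Theory Num.Theory numFieldNormedType.Exports.
Local Open Scope classical_set_scope.
Local Open Scope ring_scope.

(** Induction on [r]: the mean is the convex combination of [v i] and the mean over the tail, with
    coefficient [a i / (a i + b)] on [v i], where [b] is the total weight of the tail. *)
Lemma convex_set_mean (R : realType) (V : lmodType R) (U : set V)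
    (I : eqType) (r : seq I) (a : I -> R) (v : I -> V) :
  @convex_set R V U -> r != [::] ->
  {in r, forall i, 0 < a i} -> {in r, forall i, U (v i)} ->
  U ((\sum_(i <- r) a i)^-1 *: \sum_(i <- r) a i *: v i).
Proof.
move=> Uconv; elim: r => // i [_ _ a0 Uv|j r IH _ a0 Uv].
  have ai0 := a0 i (mem_head _ _).
  rewrite !big_seq1 scalerA mulVf ?gt_eqF// scale1r.
  by apply: Uv; rewrite mem_head.
rewrite !(big_cons _ _ i).
set b := \sum_(_ <- _) _; set y := \sum_(_ <- _) _ *: _.
have ai0 : 0 < a i by rewrite a0 ?mem_head.
have b0 : 0 < b.
  rewrite /b big_cons ltr_wpDr ?a0 ?inE ?eqxx ?orbT//.
  by rewrite big_seq sumr_ge0// => k kr; rewrite ltW// a0// !inE kr !orbT.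
have Uy : U (b^-1 *: y).
  apply: IH => // k kr; first by rewrite a0// inE kr orbT.
  by apply: Uv; rewrite inE kr orbT.
have l01 : 0 <= a i / (a i + b) <= 1.
  apply/andP; split; first by rewrite ltW// divr_gt0// addr_gt0.
  by rewrite ler_pdivrMr ?addr_gt0// mul1r lerDl ltW.
have := Uconv (v i) (b^-1 *: y) (Itv01 (andP l01).1 (andP l01).2).
rewrite !inE => /(_ (Uv i (mem_head _ _)) Uy).
congr U; rewrite /conv /= /unstable.onem /=.
rewrite scalerDr !scalerA mulrC; congr (_ + _ *: _).
by field; rewrite !gt_eqF ?addr_gt0.
Qed.

(** * Exactness of GLL quadrature on derivatives *)

Section Quadrature.
Variable R : realType.

Lemma Rintegral_deriv_poly (q : {poly R}) (a b : R) : a < b ->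
  \int[lebesgue_measure]_(x in `[a, b]) q^`().[x] = q.[b] - q.[a].
Proof.
move=> ab; rewrite /Rintegral (@continuous_FTC2 _ _ (horner q))//.
- by apply: continuous_in_subspaceT => x _; exact: continuous_horner.
- split.
  + by move=> x _; case: (is_derive_poly q x).
  + by apply: cvg_at_right_filter; exact: continuous_horner.
  + by apply: cvg_at_left_filter; exact: continuous_horner.
- by move=> x _; rewrite derive1E; case: (is_derive_poly q x).
Qed.

(** The derivative has degree at most [2N - 1], within the exactness of the rule, and its integral
    is given by the fundamental theorem of calculus. *)
Lemma GLL_sum_deriv (N : nat) (xi w : 'I_N.+1 -> R) (q : {poly R}) :
  is_GLL xi w -> (size q <= (2 * N).+1)%N ->
  \sum_j w j * q^`().[xi j] = q.[1] - q.[-1].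
Proof.
case=> _ _ _ _ exact_w sq; rewrite -exact_w.
  by rewrite Rintegral_deriv_poly// (lt_trans (ltrN10 _) ltr01).
have [->|q0] := eqVneq q 0; first by rewrite deriv0 size_poly0.
by rewrite -ltnS (leq_trans (lt_size_deriv q0)).
Qed.

Lemma size_lagrange_basis (N : nat) (xi : 'I_N.+1 -> R) (j : 'I_N.+1) :
  (size (lagrange_basis xi j) <= N.+1)%N.
Proof.
rewrite /lagrange_basis scaler_prod (leq_trans (size_scale_leq _ _))//.
by rewrite -big_filter size_prod_XsubC ltnS -cardE cardC1 card_ord.
Qed.

End Quadrature.

(* Restriction to the line through x in direction i; x i is ignored. *)
Definition line_poly {R : realType} {d : nat} (x : 'I_d -> R) (i : 'I_d) :
    mpoly d R -> {poly R} :=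
  mmap polyC (fun j => if j == i then 'X else (x j)%:P).

(** * Restriction of multivariate polynomials to a line *)

Section Line.
Variables (R : realType) (d : nat) (x : 'I_d -> R) (i : 'I_d).
HB.instance Definition _ := GRing.RMorphism.on (line_poly x i).

Lemma horner_line_poly (P : mpoly d R) (t : R) :
  (line_poly x i P).[t] = meval (fun j => if j == i then t else x j) P.
Proof.
rewrite /line_poly /meval /mmap horner_sum; apply: eq_bigr => m _.
rewrite hornerM hornerC /mmap1 horner_prod; congr (_ * _).
by apply: eq_bigr => j _; rewrite horner_exp; case: eqP; rewrite !hornerE.
Qed.

Lemma line_polyZ (c : R) (P : mpoly d R) :
  line_poly x i (c *: P) = c *: line_poly x i P.
Proof. by rewrite /line_poly mmapZ mul_polyC. Qed.

Lemma line_polyX (m : multinom d) :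
  line_poly x i (mpolyX R m) = (\prod_(j | j != i) x j ^+ m j) *: 'X^(m i).
Proof.
rewrite /line_poly mmapX /mmap1 (bigD1 i)//= eqxx mulrC -mul_polyC.
congr (_ * _); rewrite rmorph_prod /=.
by apply: eq_bigr => j /negbTE ->; rewrite rmorphXn.
Qed.

(** By linearity it suffices to treat monomials, whose restriction is a constant times a power of
    ['X]. *)
Lemma deriv_line_poly (P : mpoly d R) :
  (line_poly x i P)^`() = line_poly x i (mderiv i P).
Proof.
elim/mpolyind: P => [|c m P _ _ IH]; first by rewrite !raddf0.
rewrite mderivD mderivZ mderivX !raddfD/= !line_polyZ derivZ IH.
congr (_ *: _ + _).
rewrite !line_polyX derivZ derivXn mnmBE mnm1E eqxx subn1.
rewrite scaler_nat scalerMnr; congr (_ *: (_ *+ _)).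
apply: eq_bigr => j ji.
by rewrite mnmBE mnm1E eq_sym (negbTE ji) subn0.
Qed.

(** In a product of one-variable Lagrange polynomials, restriction makes every factor but the [i]-th
    constant, and that one has degree at most [N]. *)
Lemma size_line_poly_interp (N k : nat) (xi : 'I_N.+1 -> R)
    (v : node d N -> 'rV[R]_k) (c : 'I_k) :
  (size (line_poly x i (interp xi v 0%R c)) <= N.+1)%N.
Proof.
rewrite mxE raddf_sum (leq_trans (size_sum _ _ _))//.
apply/bigmax_leqP => p _; rewrite /= line_polyZ.
rewrite (leq_trans (size_scale_leq _ _))// rmorph_prod /=.
have factorE j :
    line_poly x i (map_poly (mpolyC d (R := R))
                     (lagrange_basis xi (p j))).[mpolyX R (mnm1 j)]
    = if j == i then lagrange_basis xi (p i)
      else (lagrange_basis xi (p j)).[x j]%:P.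
  rewrite -horner_map -map_poly_comp /=.
  rewrite (@eq_map_poly _ _ _ polyC); last first.
    by move=> a; rewrite /= /line_poly mmapC.
  rewrite /line_poly mmapX mmap1U.
  case: eqVneq => [->|_]; last by rewrite horner_map.
  exact: comp_polyXr.
rewrite (bigD1 i)//= factorE eqxx.
rewrite (eq_bigr (fun j => (lagrange_basis xi (p j)).[x j]%:P)); last first.
  by move=> j /negbTE ji; rewrite factorE ji.
rewrite -rmorph_prod mulrC /= mul_polyC.
by rewrite (leq_trans (size_scale_leq _ _))// size_lagrange_basis.
Qed.

End Line.

(** * Decomposition of the node grid into lines *)

Section Nodes.
Variables (d N : nat).
Implicit Types (p : node d N) (i : 'I_d) (l m : 'I_N.+1).

Lemma setnE p i l j : setn p i l j = if j == i then l else p j.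
Proof. by rewrite ffunE. Qed.

Lemma setn_setn p i l m : setn (setn p i l) i m = setn p i m.
Proof. by apply/ffunP => j; rewrite !setnE; case: eqP. Qed.

Lemma setn_id p i : setn p i (p i) = p.
Proof. by apply/ffunP => j; rewrite setnE; case: eqP => [->|]. Qed.

(** Each line in direction [i] is represented by its node of [i]-th index [ord0]; a node is then a
    line and a position on it. *)
Lemma sum_lines (V : nmodType) (i : 'I_d) (G : node d N -> V) :
  \sum_p G p = \sum_(p : node d N | p i == ord0) \sum_l G (setn p i l).
Proof.
rewrite pair_big /=.
rewrite (reindex_onto (fun x : node d N * 'I_N.+1 => setn x.1 i x.2)
           (fun q => (setn q i ord0, q i))) /=; last first.
  by move=> q _; rewrite setn_setn setn_id.
apply: eq_bigl => -[p l] /=; rewrite setn_setn setnE eqxx xpair_eqE eqxx !andbT.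
apply/eqP/eqP => [<-|pi0]; first by rewrite setnE eqxx.
by rewrite -pi0 setn_id.
Qed.

End Nodes.

(** * Line sums of the fluxes and element means *)

Section Conservation.
Variables (R : realType) (d s N : nat) (E : Type) (S : lwfr R d s N E).
Implicit Types (p : node d N) (i : 'I_d) (e : E) (u : state R d s N E).

Lemma enormN n (v : 'rV[R]_n) : enorm (- v) = enorm v.
Proof. by rewrite /enorm; under eq_bigr => m _ do rewrite mxE sqrrN. Qed.

(** The central part is odd in the normal and symmetric in the states; the dissipation is odd in the
    states, with [speed] unchanged. *)
Lemma inner_fluxN (um up : 'rV[R]_s) (n : 'rV[R]_d) :
  (forall um up n, speed S um up n = speed S up um (- n)) ->
  inner_flux S up um (- n) = - inner_flux S um up n.
Proof.
move=> speedC; rewrite /inner_flux enormN -scalerN; congr (_ *: _).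
rewrite /rusanov scalerN -speedC opprB -(opprB up um) scalerN opprK addrC.
congr (_ + _); rewrite -[RHS]scalerN -sumrN; congr (_ *: _).
by apply: eq_bigr => m _; rewrite mxE scaleNr [X in _ *: X]addrC.
Qed.

Lemma wnode_setn p i l :
  wnode S (setn p i l) = (\prod_(j | j != i) weight S (p j)) * weight S l.
Proof.
rewrite /wnode (bigD1 i)//= setnE eqxx mulrC; congr (_ * _).
by apply: eq_bigr => j /negbTE ji; rewrite setnE ji.
Qed.

Lemma sum_low_line u e i p :
  (forall um up n, speed S um up n = speed S up um (- n)) ->
  \sum_l (subcell_flux S u e Right i (setn p i l)
          + subcell_flux S u e Left i (setn p i l))
  = num_flux S u e Right i (face_node Right i p)
    + num_flux S u e Left i (face_node Left i p).
Proof.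
move=> speedC; rewrite big_split big_ord_recr [X in _ + X = _]big_ord_recl /=.
rewrite !setnE !eqxx /face_node !setn_setn.
rewrite [X in X + _ = _]addrC addrACA -[RHS]addr0; congr (_ + _).
(* With the two interface fluxes set apart, the Right flux at position [l] meets the Left flux at
   [l + 1] across one inner face, and they cancel. *)
rewrite -big_split big1// => l _ /=.
rewrite /node_next /normalL /node_prev !setn_setn !setnE eqxx.
have -> : inord (widen_ord (leqnSn N) l).+1 = lift ord0 l.
  by apply/val_inj; rewrite /= inordK ?ltnS.
have -> : inord (lift ord0 l).-1 = widen_ord (leqnSn N) l.
  by apply: val_inj; exact: (inordK (leqW (ltn_ord l))).
by rewrite /= ltn_eqF// inner_fluxN// subrr.
Qed.

Lemma pt_setn p i l :
  pt S (setn p i l) = fun j => if j == i then gll S l else pt S p j.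
Proof. by apply/funext => j; rewrite /pt /grid_point setnE; case: ifP. Qed.

Lemma size_line_poly_avg_flux e (v : field R d s N) i (x : 'I_d -> R) c :
  (size (line_poly x i (avg_flux S e v i 0%R c)) <= N.+1)%N.
Proof.
rewrite /avg_flux summxE raddf_sum (leq_trans (size_sum _ _ _))//.
apply/bigmax_leqP => k _; rewrite /= [X in line_poly _ _ X]mxE rmorphM /=.
rewrite {1}/line_poly mmapC mul_polyC (leq_trans (size_scale_leq _ _))//.
exact: size_line_poly_interp.
Qed.

Lemma sum_weight_vmderiv (P : 'rV[mpoly d R]_s) i p :
  is_GLL (gll S) (weight S) ->
  (forall c, (size (line_poly (pt S p) i (P 0%R c)) <= N.+1)%N) ->
  \sum_l weight S l *: vmeval (pt S (setn p i l)) (vmderiv i P)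
  = vmeval (pt S (face_node Right i p)) P
    - vmeval (pt S (face_node Left i p)) P.
Proof.
move=> gllS sP; apply/rowP => c; rewrite summxE !mxE /face_node !pt_setn.
have [[-> ->] _ _ _ _] := gllS.
rewrite -!horner_line_poly -(GLL_sum_deriv _ _ _ _ _ gllS); last first.
  by rewrite (leq_trans (sP c))// mul2n -addnn -addnS leq_addl.
by apply: eq_bigr => l _; rewrite !mxE pt_setn deriv_line_poly horner_line_poly.
Qed.

(** The summands of [high], and in [low_div] those of [low], named so that both updates fit
    [mean_update]. *)
Definition high_div u e i p : 'rV[R]_s :=
  vmeval (pt S p) (vmderiv i (avg_flux S e (u e) i))
  + (corr S Right)^`().[gll S (p i)] *: flux_jump S u e Right i p
  - (corr S Left)^`().[gll S (p i)] *: flux_jump S u e Left i p.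

Definition low_div u e i p : 'rV[R]_s :=
  (weight S (p i))^-1 *:
    (subcell_flux S u e Right i p + subcell_flux S u e Left i p).

Lemma flux_jump_setn u e sd i p l :
  flux_jump S u e sd i (setn p i l) = flux_jump S u e sd i p.
Proof. by rewrite /flux_jump /face_node setn_setn. Qed.

Lemma sum_high_line u e i p :
  (0 < N)%N -> lwfr_valid S ->
  \sum_l weight S l *: high_div u e i (setn p i l)
  = num_flux S u e Right i (face_node Right i p)
    + num_flux S u e Left i (face_node Left i p).
Proof.
move=> N0 [[gllS _ _ _ [sg [gL1 gL0] [gR0 gR1]]] _].
have sumg sd : \sum_l weight S l * (corr S sd)^`().[gll S l]
    = (corr S sd).[1] - (corr S sd).[-1].
  (* The degree [N + 1] of a correction function is at most [2N] because [1 <= N]. *)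
  rewrite (GLL_sum_deriv _ _ _ _ _ gllS)// (leq_trans (sg sd))// ltnS.
  by rewrite mul2n -addnn -addn1 leq_add2l.
rewrite /high_div.
under eq_bigr => l _.
  rewrite !flux_jump_setn setnE eqxx scalerBr scalerDr !scalerA; over.
(* The jumps are constant along the line; the right one gets the factor [1], the left one [-1]. *)
rewrite sumrB big_split /= -!scaler_suml !sumg gL1 gL0 gR0 gR1.
rewrite sum_weight_vmderiv//; last by move=> c; exact: size_line_poly_avg_flux.
rewrite subr0 sub0r scaleN1r scale1r opprK /flux_jump /=.
have -> x (P : 'rV[mpoly d R]_s) : vmeval x (- P) = - vmeval x P.
  by apply/rowP => c; rewrite !mxE raddfN.
by rewrite opprK [X in X + _ = _]addrC subrKA [X in _ + X = _]addrC subrKA.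
Qed.

Lemma sum_low_line_div u e i p :
  lwfr_valid S ->
  \sum_l weight S l *: low_div u e i (setn p i l)
  = num_flux S u e Right i (face_node Right i p)
    + num_flux S u e Left i (face_node Left i p).
Proof.
move=> [[[_ _ _ w0 _] _ _ _ _] [speedC _ _ _]].
rewrite -sum_low_line//; apply: eq_bigr => l _.
by rewrite /low_div setnE eqxx scalerA mulfV ?scale1r// gt_eqF.
Qed.

(** The Jacobian weight of the mean cancels the [1 / J] of the update and [wnode] factors along
    lines, so [D] enters only through its weighted line sums. *)
Lemma mean_update (v' v : state R d s N E) (D : 'I_d -> field R d s N) e :
  (forall p, 0 < jac S e p) ->
  (forall p, v' e p = v e p - (dt S / jac S e p) *: \sum_i D i p) ->
  mean S v' e
  = mean S v e - ((\sum_p jac S e p * wnode S p)^-1 * dt S) *: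
      \sum_i \sum_(p : node d N | p i == ord0)
        \prod_(j | j != i) weight S (p j) *:
          \sum_l weight S l *: D i (setn p i l).
Proof.
move=> J0 v'E; rewrite /mean -scalerA -scalerBr; congr (_ *: _).
under eq_bigr => p _ do rewrite v'E scalerBr.
rewrite sumrB; congr (_ - _).
transitivity (dt S *: \sum_p \sum_i wnode S p *: D i p).
  rewrite scaler_sumr; apply: eq_bigr => p _; rewrite -scaler_sumr !scalerA.
  by congr (_ *: _); field; rewrite gt_eqF.
rewrite exchange_big /=; congr (_ *: _); apply: eq_bigr => i _.
rewrite (sum_lines _ _ _ i) /=; apply: eq_bigr => p _.
by rewrite scaler_sumr; apply: eq_bigr => l _; rewrite wnode_setn scalerA.
Qed.

Lemma mean_low_high u e :
  (0 < N)%N -> lwfr_valid S -> mean S (low S u) e = mean S (high S u) e.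
Proof.
move=> N0 Sv; have [[_ J0 _ _ _] _] := Sv.
have J0e p : 0 < jac S e p by case: (J0 e p).
rewrite (mean_update (low S u) u (low_div u e))//.
rewrite (mean_update (high S u) u (high_div u e))//.
congr (_ - _ *: _); apply: eq_bigr => i _; apply: eq_bigr => p _.
by rewrite sum_low_line_div// sum_high_line.
Qed.

(** Since [blend] has one value per element, it can be pulled out of the sum over nodes. *)
Lemma mean_blended u e :
  mean S (high S u) e = mean S (low S u) e ->
  mean S (blended S u) e = mean S (low S u) e.
Proof.
move=> hl; rewrite -[RHS]scale1r -(subrK (blend S u e) 1) scalerDl -{1}hl.
rewrite /mean [X in _ = X + _]scalerA [X in _ = _ + X]scalerA.
rewrite mulrC [X in _ = _ + X *: _]mulrC -!scalerA -scalerDr; congr (_ *: _).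
rewrite !scaler_sumr -big_split; apply: eq_bigr => p _.
rewrite /= /blended scalerDr !scalerA.
by congr (_ *: _ + _ *: _); rewrite mulrC.
Qed.

End Conservation.

Theorem theorem1 (R : realType) (d s N : nat) (E : Type)
    (S : lwfr R d s N E) (U : set 'rV[R]_s) :
  (0 < N)%N ->
  lwfr_valid S ->
  @convex_set R 'rV[R]_s U ->
  [/\ forall (u : state R d s N E) (e : E),
        mean S (low S u) e = mean S (high S u) e,
      adm_preserving_in_means S U (blended S)
        <-> adm_preserving_in_means S U (low S)
    & (forall u : state R d s N E, admissible U u ->
         forall (e : E) (p : node d N),
           (forall i : 'I_d, (0 < p i)%N /\ (p i < N)%N) ->
           U (low S u e p)) ->
      (forall u : state R d s N E, admissible U u ->
         forall (e : E) (p : node d N),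
           (exists i : 'I_d, p i = 0%N :> nat \/ p i = N :> nat) ->
           U (low S u e p)) ->
      adm_preserving_in_means S U (blended S)].
Proof.
move=> N0 Sv Uconv.
have lowhigh u e : mean S (low S u) e = mean S (high S u) e.
  exact: mean_low_high.
have blendE u e : mean S (blended S u) e = mean S (low S u) e.
  exact: mean_blended.
split=> //; first by split=> adm u Uu e; have := adm u Uu e; rewrite blendE.
move=> inner outer u Uu e; rewrite blendE.
have [[[_ _ _ w0 _] J0 _ _ _] _] := Sv.
apply: convex_set_mean => //.
(* The corner node shows that the index list is not empty. *)
- apply/eqP => r0; have := mem_index_enum ([ffun=> ord0] : node d N).
  by rewrite r0.
- by move=> p _; rewrite mulr_gt0 ?prodr_gt0//; case: (J0 e p).
move=> p _.
case: (pselect (exists i : 'I_d, p i = 0%N :> nat \/ p i = N :> nat)).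
  exact: outer.
move=> /forallNP pin; apply: inner => // i; split.
  by rewrite lt0n; apply/eqP => pi0; apply: (pin i); left.
rewrite ltn_neqAle -ltnS ltn_ord andbT.
by apply/eqP => piN; apply: (pin i); right.
Qed.
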